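(* Let $G$ be a group and let $Z$ be a normed $G$-module with finite balls such that $G$ acts on $Z$ via finitely many automorphisms. Then $$\{\omega_b(G,N,\psi)\in \mathrm{H}^3_b(G,Z)\mid N \text{ a group with } Z(N)=Z,\ \psi\colon G\to\mathrm{Out}(N)\text{ a homomorphism with finite image inducing the given action of } G \text{ on } Z\}=\mathcal{F}(G,Z)$$ as subsets of $\mathrm{H}^3_b(G,Z)$, where $$\mathcal{F}(G,Z)=\{\Phi^*\alpha\in \mathrm{H}^3_b(G,Z)\mid \Phi\colon G\to M\text{ a homomorphism},\ M\text{ a finite group},\ \alpha\in \mathrm{H}^3_b(M,Z)\}.$$
   Context: Notation: for an automorphism $\alpha$, ${}^{\alpha}n=\alpha(n)$; for a group element $a$, ${}^{a}n=ana^{-1}$. $Z(N)$ is the centre of $N$; ''$Z(N)=Z$'' means that the centre is identified with the abelian group $Z$. A norm on a $G$-module $V$ is a map $\|\cdot\|\colon V\to[0,\infty)$ with $\|v\|=0$ iff $v=0$; $\|rv\|\le|r|\|v\|$ for $r\in\mathbb{Z}$; $\|v+w\|\le\|v\|+\|w\|$; and $\|gv\|=\|v\|$ for $g\in G$. It has finite balls if $\{v\in V:\|v\|\le K\}$ is finite for every $K>0$. Bounded cohomology: $C^0_b(G,V)=V$ and for $n\ge1$, $C^n_b(G,V)$ is the set of functions $\alpha\colon G^n\to V$ with $\sup\|\alpha(g_1,\dots,g_n)\|<\infty$. The coboundary is $\delta^0(v)(g)=g\cdot v-v$ and, for $n\ge1$, $\delta^n(\alpha)(g_1,\dots,g_{n+1})=g_1\cdot\alpha(g_2,\dots,g_{n+1})+\sum_{i=1}^n(-1)^i\alpha(g_1,\dots,g_ig_{i+1},\dots,g_{n+1})+(-1)^{n+1}\alpha(g_1,\dots,g_n)$.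 $\mathrm{H}^n_b(G,V)$ is the cohomology of $(C^*_b(G,V),\delta^* )$; $\mathrm{H}^n(G,V)$ is defined in the same way with all functions in place of bounded ones. In the definition of $\mathcal{F}(G,Z)$, the abelian group $Z$ carries an $M$-module structure whose pullback along $\Phi$ is the given $G$-module structure on $Z$; $\Phi^*\alpha$ is the pullback of $\alpha$ along $\Phi$. As $M$ is finite, all cochains on $M$ are bounded and $\mathrm{H}^3(M,Z)=\mathrm{H}^3_b(M,Z)$. A homomorphism $\psi\colon G\to\mathrm{Out}(N)$ induces an action of $G$ on $Z(N)$ by $g\cdot z={}^{\phi(g)}z$, where $\phi(g)\in\mathrm{Aut}(N)$ is any representative of $\psi(g)$. Definition of $\omega_b(G,N,\psi)$, for $\psi\colon G\to\mathrm{Out}(N)$ a homomorphism with finite image and $Z=Z(N)$ normed with finite balls: choose a set-theoretic lift $\phi\colon G\to\mathrm{Aut}(N)$ of $\psi$ with finite image and $\phi(1)=1$, and a function $\zeta\colon G\times G\to N$ with finite image, with $\zeta(1,g)=\zeta(g,1)=1$ for all $g$, and such that ${}^{\zeta(g,h)}n={}^{\phi(g)\phi(h)\phi(gh)^{-1}}n$ for all $g,h\in G$, $n\in N$. Define $o_b\colon G^3\to N$ by ${}^{\phi(g)}\zeta(h,i)\,\zeta(g,hi)=o_b(g,h,i)\,\zeta(g,h)\,\zeta(gh,i)$. Then $o_b$ takes values in $Z$ and is a bounded cocycle, whose class $\omega_b(G,N,\psi):=[o_b]\in\mathrm{H}^3_b(G,Z)$ does not depend on the choices of $\phi$ and $\zeta$.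 *)

(* Defs.v *)
From HB Require Import structures.
From mathcomp Require Import all_boot all_order all_algebra.
From mathcomp Require Import fingroup generic_quotient ring_quotient.
From mathcomp Require Import all_classical reals.

Set Implicit Arguments.
Unset Strict Implicit.
Unset Printing Implicit Defensive.

Import Order.TTheory GRing.Theory Num.Theory.

Local Open Scope quotient_scope.
Local Open Scope classical_set_scope.
Local Open Scope ring_scope.

Record gmodule (G : groupType) (Z : zmodType) := GModule {
  gact :> G -> Z -> Z;
  gact1 : forall z, gact 1%g z = z;
  gactM : forall g h z, gact (g * h)%g z = gact g (gact h z);
  gactD : forall g z w, gact g (z + w) = gact g z + gact g w }.

Record znorm (R : realType) (Z : zmodType) := ZNorm {
  znorm_val :> Z -> R;
  znorm_ge0 : forall z, 0 <= znorm_val z;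
  znorm_eq0 : forall z, znorm_val z = 0 <-> z = 0;
  znormMz : forall z (r : int), znorm_val (z *~ r) <= `|r|%:~R * znorm_val z;
  znormD : forall z w, znorm_val (z + w) <= znorm_val z + znorm_val w }.

Definition norm_invariant (G : groupType) (Z : zmodType) (R : realType)
  (rho : gmodule G Z) (nu : znorm R Z) := forall g z, nu (rho g z) = nu z.

Definition finite_balls (Z : zmodType) (R : realType) (nu : znorm R Z) :=
  forall K : R, 0 < K -> finite_set [set z | nu z <= K].

Section BoundedCohomology.
Variables (R : realType) (G : groupType) (Z : zmodType).
Variables (rho : gmodule G Z) (nu : znorm R Z).

(* (g_0, ..., g_n) |-> (g_0, ..., g_i g_(i+1), ..., g_n) *)
Definition merge_face n (i : 'I_n) (t : n.+1.-tuple G) : n.-tuple G :=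
  [tuple if (j < i)%N then tnth t (widen_ord (leqnSn n) j)
         else if j == i then (tnth t (widen_ord (leqnSn n) j)
                              * tnth t (lift ord0 j))%g
         else tnth t (lift ord0 j) | j < n].

Definition last_face n (t : n.+1.-tuple G) : n.-tuple G :=
  [tuple tnth t (widen_ord (leqnSn n) j) | j < n].

(* Entries are numbered from 0, hence the exponent i + 1. For n = 0 the cochain
   is a value v on the empty tuple and this is g |-> g v - v. *)
Definition coboundary n (a : n.-tuple G -> Z) : n.+1.-tuple G -> Z := fun t =>
  rho (thead t) (a [tuple of behead t])
  + \sum_(i < n) a (merge_face i t) *~ (-1) ^+ i.+1
  + a (last_face t) *~ (-1) ^+ n.+1.

Definition bounded_cochain n (a : n.-tuple G -> Z) :=
  exists K : R, forall t, nu (a t) <= K.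

Lemma gact0 g : rho g 0 = 0.
Proof. by apply: (addrI (rho g 0)); rewrite -gactD !addr0. Qed.

Lemma gactN g z : rho g (- z) = - rho g z.
Proof. by apply: (addrI (rho g z)); rewrite -gactD !subrr gact0. Qed.

Lemma znorm0 : nu 0 = 0.
Proof. by apply/znorm_eq0. Qed.

Lemma znormN_le z : nu (- z) <= nu z.
Proof. by have := znormMz nu z (-1); rewrite mulrN1z normrN normr1 mul1r. Qed.

Lemma bounded_cochain0 n : bounded_cochain (0 : n.-tuple G -> Z).
Proof. by exists 0 => t; rewrite znorm0. Qed.

Lemma bounded_cochainB n (a b : n.-tuple G -> Z) :
  bounded_cochain a -> bounded_cochain b -> bounded_cochain (a - b).
Proof.
move=> [K aK] [L bL]; exists (K + L) => t.
apply: le_trans (znormD _ _ _) _.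
by apply: lerD (aK t) _; apply: le_trans (znormN_le _) (bL t).
Qed.

Lemma coboundaryB n (a b : n.-tuple G -> Z) :
  coboundary (a - b) = coboundary a - coboundary b.
Proof.
have subE m (x y : m.-tuple G -> Z) t : (x - y) t = x t - y t by [].
apply/funext => t; rewrite subE /coboundary !subE gactD gactN mulrzBl.
under eq_bigr do rewrite subE mulrzBl.
by rewrite sumrB opprD [RHS]addrACA opprD [X in _ = X + _]addrACA.
Qed.

Lemma coboundary0 n : coboundary (0 : n.-tuple G -> Z) = 0.
Proof. by rewrite -[0 in LHS](subrr 0) coboundaryB subrr. Qed.

Definition bcocycle_pred n (a : n.-tuple G -> Z) : bool :=
  `[< bounded_cochain a /\ coboundary a = 0 >].

Fact bcocycle_pred_closed n : zmod_closed (@bcocycle_pred n).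
Proof.
split=> [|a b].
  by apply/asboolP; split; [exact: bounded_cochain0 | exact: coboundary0].
move=> /asboolP[aB a0] /asboolP[bB b0]; apply/asboolP; split.
  exact: bounded_cochainB.
by rewrite coboundaryB a0 b0 subrr.
Qed.

HB.instance Definition _ n :=
  GRing.isZmodClosed.Build (n.-tuple G -> Z) (@bcocycle_pred n)
    (@bcocycle_pred_closed n).

(* Invariance of the norm is not required: for a module with a norm that is not
   invariant, bcohomology is the quotient of the bounded cocycles by those which
   are coboundaries of a bounded cochain. *)
Record bcocycle n := BCocycle {
  bcocycle_val :> n.-tuple G -> Z;
  bcocycleP : bcocycle_pred bcocycle_val }.

HB.instance Definition _ n := [isSub for @bcocycle_val n].
HB.instance Definition _ n := [Choice of bcocycle n by <:].
HB.instance Definition _ n := [SubChoice_isSubZmodule of bcocycle n by <:].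

Definition is_bcoboundary n : (n.-tuple G -> Z) -> Prop :=
  match n with
  | 0 => fun a => a = 0
  | m.+1 => fun a => exists2 b : m.-tuple G -> Z,
      bounded_cochain b & coboundary b = a
  end.

Definition bcoboundary_pred n (a : bcocycle n) : bool :=
  `[< is_bcoboundary (a : n.-tuple G -> Z) >].

Fact bcoboundary_pred_closed n : zmod_closed (@bcoboundary_pred n).
Proof.
split=> [|a b].
  case: n => [|n]; apply/asboolP => //=; exists 0; first exact: bounded_cochain0.
  exact: coboundary0.
case: n a b => [|n] a b /asboolP/= aP /asboolP/= bP; apply/asboolP => /=.
  rewrite -[LHS]/((a : 0.-tuple G -> Z) - (b : 0.-tuple G -> Z)).
  by rewrite aP bP subrr.
case: aP bP => [a' a'B aE] [b' b'B bE]; exists (a' - b').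
  exact: bounded_cochainB.
by rewrite coboundaryB aE bE.
Qed.

HB.instance Definition _ n :=
  GRing.isZmodClosed.Build (bcocycle n) (@bcoboundary_pred n)
    (@bcoboundary_pred_closed n).

Definition bcoboundaries n : zmodClosed (bcocycle n) :=
  GRing.ZmodClosed.clone (bcocycle n) (@bcoboundary_pred n) _.

Definition bcohomology n : zmodType := Quotient.quot (bcoboundaries n).

Definition bclass n (a : bcocycle n) : bcohomology n :=
  \pi_(Quotient.quot (bcoboundaries n)) a.

End BoundedCohomology.

Section Pullback.
Variables (R : realType) (G M : groupType) (Z : zmodType) (nu : znorm R Z).
Variables (rho : gmodule G Z) (sigma : gmodule M Z).
Variables (Phi : {multiplicative G -> M}).
Hypothesis PhiE : forall g z, sigma (Phi g) z = rho g z.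

Definition pull_cochain n (a : n.-tuple M -> Z) : n.-tuple G -> Z :=
  fun t => a (map_tuple Phi t).

Lemma pull_cochain_bounded n (a : n.-tuple M -> Z) :
  bounded_cochain nu a -> bounded_cochain nu (pull_cochain a).
Proof. by case=> K aK; exists K => t; apply: aK. Qed.

Lemma coboundary_pull n (a : n.-tuple M -> Z) :
  coboundary rho (pull_cochain a) = pull_cochain (coboundary sigma a).
Proof.
apply/funext => t; rewrite /coboundary /pull_cochain.
congr (_ + _ + _).
- rewrite -PhiE; congr (sigma _ (a _)); first by rewrite !/thead tnth_map.
  by apply/val_inj; rewrite /= behead_map.
- apply: eq_bigr => i _; congr (a _ *~ _); apply: eq_from_tnth => j.
  rewrite tnth_map !tnth_mktuple !tnth_map.
  by case: ifP => // _; case: ifP => // _; rewrite gmulfM.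
- congr (a _ *~ _); apply: eq_from_tnth => j.
  by rewrite tnth_map !tnth_mktuple tnth_map.
Qed.

Fact pull_bcocycle_subproof n (a : bcocycle sigma nu n) :
  bcocycle_pred rho nu (pull_cochain a).
Proof.
have /asboolP[aB a0] := bcocycleP a; apply/asboolP; split.
  exact: pull_cochain_bounded.
by rewrite coboundary_pull a0.
Qed.

Definition pull_bcocycle n (a : bcocycle sigma nu n) : bcocycle rho nu n :=
  BCocycle (pull_bcocycle_subproof a).

(* Independent of the representative: see pullback_class. *)
Definition pullback n (x : bcohomology sigma nu n) : bcohomology rho nu n :=
  bclass (pull_bcocycle (repr x)).

Lemma pullback_class n (a : bcocycle sigma nu n) :
  pullback (bclass a) = bclass (pull_bcocycle a).
Proof.
apply/eqP; rewrite /pullback /bclass -Quotient.idealrBE.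
have : repr (bclass a) - a \in bcoboundaries sigma nu n.
  by rewrite Quotient.idealrBE reprK.
case: n a => [|n] a /asboolP/= aP; apply/asboolP => /=.
  by apply/funext => t; have := congr1 (fun f => f (map_tuple Phi t)) aP.
case: aP => b bB bE; exists (pull_cochain b); first exact: pull_cochain_bounded.
by rewrite coboundary_pull bE.
Qed.

End Pullback.

Section Automorphisms.
Variable N : groupType.

(* On autg, rewriting with mulgA leaves terms in which the cancellation lemmas
   (mulgK, mulgVK) are no longer found; this instance of it does not. *)
Lemma gmulA (H : groupType) (x y z : H) : (x * (y * z) = x * y * z)%g.
Proof. exact: mulgA. Qed.

Record autg := AutG {
  autg_fun :> N -> N;
  autgM : {morph autg_fun : x y / (x * y)%g};
  autg_bij : bijective autg_fun }.

Lemma autg_eqP (a b : autg) : a =1 b -> a = b.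
Proof.
case: a b => [a aM aB] [b bM bB] /= /funext ab; case: _ / ab in bM bB *.
by congr AutG; exact: Prop_irrelevance.
Qed.

HB.instance Definition _ := gen_eqMixin autg.
HB.instance Definition _ := gen_choiceMixin autg.

Definition autg_one : autg := @AutG id (fun _ _ => erefl) (inv_bij (fun _ => erefl)).

Fact autg_mul_morph (a b : autg) : {morph a \o b : x y / (x * y)%g}.
Proof. by move=> x y; rewrite /= !autgM. Qed.

Definition autg_mul (a b : autg) : autg :=
  AutG (autg_mul_morph a b) (bij_comp (autg_bij a) (autg_bij b)).

Fact autg_inv_ex (a : autg) : exists b : autg, cancel a b /\ cancel b a.
Proof.
case: (autg_bij a) => f af fa.
have fM : {morph f : x y / (x * y)%g}.
  by move=> x y; apply: (bij_inj (autg_bij a)); rewrite autgM !fa.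
have fB : bijective f by exists a.
by exists (AutG fM fB).
Qed.

Definition autg_inv (a : autg) : autg := sval (cid (autg_inv_ex a)).

Lemma autg_invK (a : autg) : cancel a (autg_inv a).
Proof. by rewrite /autg_inv; case: cid => b []. Qed.

Lemma autg_invKV (a : autg) : cancel (autg_inv a) a.
Proof. by rewrite /autg_inv; case: cid => b []. Qed.

Fact autg_mulA : associative autg_mul.
Proof. by move=> a b c; apply: autg_eqP. Qed.
Fact autg_mul1 : left_id autg_one autg_mul.
Proof. by move=> a; apply: autg_eqP. Qed.
Fact autg_mulr1 : right_id autg_one autg_mul.
Proof. by move=> a; apply: autg_eqP. Qed.
Fact autg_mulV : left_inverse autg_one autg_inv autg_mul.
Proof. by move=> a; apply: autg_eqP => x; exact: autg_invK. Qed.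
Fact autg_mulrV : right_inverse autg_one autg_inv autg_mul.
Proof. by move=> a; apply: autg_eqP => x; exact: autg_invKV. Qed.

HB.instance Definition _ :=
  isGroup.Build autg autg_mulA autg_mul1 autg_mulr1 autg_mulV autg_mulrV.

Lemma autgME (a b : autg) x : (a * b)%g x = a (b x). Proof. by []. Qed.
Lemma autg1E x : (1%g : autg) x = x. Proof. by []. Qed.

Lemma autg1 (a : autg) : a 1%g = 1%g.
Proof. by apply: (mulgI (a 1%g)); rewrite -autgM !mulg1. Qed.

Lemma autgV (a : autg) x : a (x^-1)%g = ((a x)^-1)%g.
Proof. by apply: (mulgI (a x)); rewrite -autgM !mulgV autg1. Qed.

Fact inner_morph (n : N) : {morph (fun x => n * x * n^-1)%g : x y / (x * y)%g}.
Proof. by move=> x y; rewrite !mulgA mulgKV. Qed.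

Fact inner_bij (n : N) : bijective (fun x => n * x * n^-1)%g.
Proof.
exists (fun x => n^-1 * x * n)%g => x.
  by rewrite !mulgA mulVg mul1g mulgKV.
by rewrite !mulgA mulgV mul1g mulgK.
Qed.

Definition inner (n : N) : autg := AutG (@inner_morph n) (@inner_bij n).

Lemma innerM m n : inner (m * n)%g = (inner m * inner n)%g.
Proof. by apply: autg_eqP => x /=; rewrite invgM !mulgA. Qed.

Lemma inner1 : inner 1%g = 1%g.
Proof. by apply: autg_eqP => x /=; rewrite invg1 mulg1 mul1g. Qed.

Lemma innerV n : inner (n^-1)%g = ((inner n)^-1)%g.
Proof. by apply: (mulgI (inner n)); rewrite -innerM !mulgV inner1. Qed.

Lemma inner_conj (a : autg) n : (a * inner n * a^-1)%g = inner (a n).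
Proof.
apply: autg_eqP => x; rewrite !autgME /= !autgM autgV.
by rewrite (autg_invKV a).
Qed.

Definition same_outer (a b : autg) : bool :=
  `[< exists n, (a * b^-1)%g = inner n >].

Fact same_outer_equiv : equiv_class_of same_outer.
Proof.
split=> [a|a b|b a c].
- by apply/asboolP; exists 1%g; rewrite mulgV inner1.
- by apply/asboolP/asboolP => -[n E]; exists (n^-1)%g;
    rewrite innerV -E invgM invgK.
- move=> /asboolP[m Em] /asboolP[n En]; apply/asboolP; exists (m * n)%g.
  by rewrite innerM -Em -En !gmulA mulgVK.
Qed.

Canonical same_outer_equivRel := EquivRelPack same_outer_equiv.

Definition outg := {eq_quot same_outer}.
HB.instance Definition _ := EqQuotient.on outg.
HB.instance Definition _ := Choice.on outg.

Definition outer (a : autg) : outg := \pi_outg a.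

Lemma outerP (a b : autg) : outer a = outer b <-> exists n, a = (inner n * b)%g.
Proof.
split.
  by move=> /eqmodP/asboolP[n E]; exists n; rewrite -E mulgVK.
by case=> n ->; apply/eqmodP/asboolP; exists n; rewrite mulgK.
Qed.

Definition outg_one : outg := outer 1%g.
Definition outg_mul (x y : outg) : outg := outer (repr x * repr y)%g.
Definition outg_inv (x : outg) : outg := outer (repr x)^-1%g.

Lemma repr_outer (a : autg) : exists n, repr (outer a) = (inner n * a)%g.
Proof. by apply/outerP; rewrite /outer reprK. Qed.

Lemma outerM : {morph outer : a b / (a * b)%g >-> outg_mul a b}.
Proof.
move=> a b; rewrite /outg_mul.
have [m ->] := repr_outer a; have [n ->] := repr_outer b.
apply/esym/outerP; exists (m * a n)%g.
by rewrite innerM -inner_conj !gmulA mulgVK.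
Qed.

Lemma outerV : {morph outer : a / (a^-1)%g >-> outg_inv a}.
Proof.
move=> a; rewrite /outg_inv; have [m ->] := repr_outer a.
apply/esym/outerP; exists ((a^-1)%g (m^-1)%g).
by rewrite -inner_conj invgK mulgK invgM innerV.
Qed.

Lemma reprO (x : outg) : outer (repr x) = x. Proof. by rewrite /outer reprK. Qed.

Fact outg_mulA : associative outg_mul.
Proof.
by move=> x y z; rewrite -(reprO x) -(reprO y) -(reprO z) -!outerM gmulA.
Qed.
Fact outg_mul1 : left_id outg_one outg_mul.
Proof. by move=> x; rewrite -(reprO x) -outerM mul1g. Qed.
Fact outg_mulr1 : right_id outg_one outg_mul.
Proof. by move=> x; rewrite -(reprO x) -outerM mulg1. Qed.
Fact outg_mulV : left_inverse outg_one outg_inv outg_mul.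
Proof. by move=> x; rewrite -(reprO x) -outerV -outerM mulVg. Qed.
Fact outg_mulrV : right_inverse outg_one outg_inv outg_mul.
Proof. by move=> x; rewrite -(reprO x) -outerV -outerM mulgV. Qed.

HB.instance Definition _ :=
  isGroup.Build outg outg_mulA outg_mul1 outg_mulr1 outg_mulV outg_mulrV.

Definition center_of : set N := [set x | forall y, (x * y = y * x)%g].

End Automorphisms.
Arguments center_of : clear implicits.

(* The identification of the additive group Z with the centre of N. *)
Record is_center_embedding (N : groupType) (Z : zmodType) (iota : Z -> N) :
    Prop := CenterEmbedding {
  iotaD : forall z w, iota (z + w) = (iota z * iota w)%g;
  iota_inj : injective iota;
  iota_range : range iota = center_of N }.

Definition induces_action (G N : groupType) (Z : zmodType) (rho : gmodule G Z)
    (iota : Z -> N) (psi : G -> outg N) :=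
  forall g (a : autg N), outer a = psi g ->
  forall z, a (iota z) = iota (rho g z).

Record obstruction_choice (G N : groupType) (psi : G -> outg N)
    (phi : G -> autg N) (zeta : G -> G -> N) : Prop := ObstructionChoice {
  phi_lift : forall g, outer (phi g) = psi g;
  phi_finite : finite_set (range phi);
  phi1 : phi 1%g = 1%g;
  zeta_finite : finite_set (range (fun p : G * G => zeta p.1 p.2));
  zeta1g : forall g, zeta 1%g g = 1%g;
  zetag1 : forall g, zeta g 1%g = 1%g;
  zetaE : forall g h n,
    (zeta g h * n * (zeta g h)^-1)%g = (phi g * phi h * (phi (g * h))^-1)%g n }.

Definition is_obstruction (G N : groupType) (phi : G -> autg N)
    (zeta : G -> G -> N) (o : G -> G -> G -> N) :=
  forall g h i, (phi g (zeta h i) * zeta g (h * i)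
                 = o g h i * zeta g h * zeta (g * h) i)%g.

Section Obstruction.
Variables (R : realType) (G N : groupType) (Z : zmodType).
Variables (rho : gmodule G Z) (nu : znorm R Z).
Variables (iota : Z -> N) (psi : {multiplicative G -> outg N}).

Definition is_obstruction_cocycle (c : bcocycle rho nu 3) :=
  exists (phi : G -> autg N) (zeta : G -> G -> N),
    obstruction_choice psi phi zeta /\
    is_obstruction phi zeta (fun g h i => iota (c [tuple g; h; i])).

Hypothesis iotaP : is_center_embedding iota.
Hypothesis psi_finite : finite_set (range psi).
Hypothesis psi_rho : induces_action rho iota psi.

Let iotaC z x : (iota z * x = x * iota z)%g.
Proof. by have : center_of N (iota z) by rewrite -(iota_range iotaP); exists z. Qed.

Let iota0 : iota 0 = 1%g.
Proof. by apply: (mulgI (iota 0)); rewrite -(iotaD iotaP) addr0 mulg1. Qed.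

Let outer1 : psi 1%g = outer 1%g.
Proof. by apply: (mulgI (psi 1%g)); rewrite -gmulfM !mulg1. Qed.

Lemma obstruction_choice_exists : exists phi zeta, obstruction_choice psi phi zeta.
Proof.
pose s (x : outg N) : autg N := if x == outer 1%g then 1%g else repr x.
have sP x : outer (s x) = x.
  by rewrite /s; case: eqP => [->|_] //; rewrite reprO.
pose phi g := s (psi g).
have phi1 : phi 1%g = 1%g by rewrite /phi outer1 /s eqxx.
pose t (a : autg N) : N :=
  if a == 1%g then 1%g else if pselect (exists n, a = inner n) is left e
  then sval (cid e) else 1%g.
have tP a : (exists n, a = inner n) -> inner (t a) = a.
  move=> e; rewrite /t; case: eqP => [->|_]; first exact: inner1.
  by case: pselect => // e'; case: cid => n /= ->.
have t1 : t 1%g = 1%g by rewrite /t eqxx.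
pose d g h : autg N := (phi g * phi h * (phi (g * h))^-1)%g.
exists phi, (fun g h => t (d g h)); split.
- by move=> g; exact: sP.
- apply: sub_finite_set (finite_image s psi_finite) => _ [g _ <-].
  by exists (psi g) => //; exists g.
- exact: phi1.
- pose f (x y : outg N) := t (s x * s y * (s (x * y))^-1)%g.
  apply: sub_finite_set (finite_image2 f psi_finite psi_finite).
  move=> _ [[g h] _ <-]; exists (psi g); first by exists g.
  by exists (psi h); [exists h | rewrite /f /d /phi gmulfM].
- by move=> g; rewrite /d phi1 !mul1g mulgV t1.
- by move=> g; rewrite /d phi1 !mulg1 mulgV t1.
- move=> g h n; rewrite -[LHS]/(inner (t (d g h)) n) tP //.
  have /outerP[m E] : outer (phi g * phi h)%g = outer (phi (g * h)%g).
    by rewrite sP gmulfM outerM !sP.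
  by exists m; rewrite /d E mulgK.
Qed.

Section Choice.
Variables (phi : G -> autg N) (zeta : G -> G -> N).
Hypothesis choiceP : obstruction_choice psi phi zeta.

Let o g h i : N :=
  (phi g (zeta h i) * zeta g (h * i) * (zeta g h * zeta (g * h) i)^-1)%g.

Let oE : is_obstruction phi zeta o.
Proof. by move=> g h i; rewrite /o -[RHS]gmulA mulgVK. Qed.

Let phi_comp g h x :
  (phi g (phi h x) = zeta g h * phi (g * h)%g x * (zeta g h)^-1)%g.
Proof. by rewrite (zetaE choiceP) -[in RHS]autgME mulgVK. Qed.

Let o_center g h i : center_of N (o g h i).
Proof.
set w := (zeta g h * zeta (g * h)%g i)%g.
have key y : (w * phi (g * h * i) y * w^-1 =
              o g h i * (w * phi (g * h * i) y * w^-1) * (o g h i)^-1)%g.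
  have E1 : (phi g (phi h (phi i y)) = o g h i * w * phi (g * h * i) y
      * (o g h i * w)^-1)%g.
    rewrite /w gmulA -oE (phi_comp h i) !autgM autgV (phi_comp g (h * i)%g) gmulA.
    by rewrite invgM !gmulA.
  have E2 : (phi g (phi h (phi i y)) = w * phi (g * h * i) y * w^-1)%g.
    by rewrite phi_comp phi_comp /w invgM !gmulA.
  by rewrite -[LHS]E2 E1 invgM !gmulA.
move=> x; have [f _ fK] := autg_bij (phi (g * h * i)%g).
clearbody w; have conjK : (w * (w^-1 * x * w) * w^-1)%g = x.
  by rewrite -!gmulA mulgV mulg1 mulVKg.
by have := key (f (w^-1 * x * w)%g); rewrite fK conjK => {2}->; rewrite mulgVK.
Qed.

Let z g h i : Z := sval (cid2 (eq_ind_r (@^~ (o g h i)) (o_center g h i)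
  (iota_range iotaP))).

Let zE g h i : iota (z g h i) = o g h i.
Proof. by rewrite /z; case: cid2. Qed.

Let o1 : 'I_3 := Ordinal (isT : 1 < 3)%N.
Let o2 : 'I_3 := Ordinal (isT : 2 < 3)%N.

Let zcochain (t : 3.-tuple G) : Z :=
  z (tnth t ord0) (tnth t o1) (tnth t o2).

Let zcochain_bounded : bounded_cochain nu zcochain.
Proof.
have oN : finite_set (range (fun t : G * G * G => o t.1.1 t.1.2 t.2)).
  pose f (a b : N) := (a * b)%g; pose d (a b : N) := (a * b^-1)%g.
  pose Z2 := range (fun p : G * G => zeta p.1 p.2).
  pose ev (a : autg N) (n : N) := a n.
  have fin2 := zeta_finite choiceP.
  have finev := finite_image2 ev (phi_finite choiceP) fin2.
  apply: sub_finite_set (finite_image2 d (finite_image2 f finev fin2)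
                          (finite_image2 f fin2 fin2)).
  move=> _ [[[g h] i] _ <-] /=.
  exists (phi g (zeta h i) * zeta g (h * i))%g.
    exists (phi g (zeta h i)).
      by exists (phi g); [exists g | exists (zeta h i); [exists (h, i) |]].
    by exists (zeta g (h * i)%g) => //; exists (g, (h * i)%g).
  exists (zeta g h * zeta (g * h) i)%g => //.
  exists (zeta g h); first by exists (g, h).
  by exists (zeta (g * h)%g i) => //; exists ((g * h)%g, i).
have zN : finite_set (range (fun t : G * G * G => nu (z t.1.1 t.1.2 t.2))).
  pose r (n : N) := nu (xget 0 [set x | iota x = n]).
  apply: sub_finite_set (finite_image r oN) => _ [t _ <-].
  exists (o t.1.1 t.1.2 t.2); first by exists t.
  congr (nu _); apply: (iota_inj iotaP); rewrite zE.
  by case: xgetP => [x _ //|/(_ (z t.1.1 t.1.2 t.2))]; rewrite /= zE.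
have /finite_seqP[s sE] := zN.
exists (\sum_(x <- s) `|x|) => t.
have : (nu (zcochain t)) \in s.
  have : [set` s] (nu (zcochain t)).
    by rewrite -sE; exists (tnth t ord0, tnth t o1, tnth t o2).
  by [].
move=> ts; rewrite (big_rem _ ts) /=; apply: le_trans (ler_norm _) _.
by rewrite lerDl sumr_ge0.
Qed.

Let z_cocycle g h i j : rho g (z h i j) - z (g * h)%g i j + z g (h * i)%g j
  - z g h (i * j)%g + z g h i = 0.
Proof.
clear zcochain_bounded zcochain; clearbody z o.
have iotaCo g' h' i' x : (o g' h' i' * x = x * o g' h' i')%g by exact: o_center.
have actE : iota (rho g (z h i j)) = phi g (o h i j).
  by rewrite -zE (psi_rho (phi_lift choiceP g)).
have phio x : (phi g (o h i j) * x = x * phi g (o h i j))%g.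
  by rewrite -actE iotaC.
set A := (phi g (phi h (zeta i j) * zeta h (i * j)) * zeta g (h * i * j))%g.
set W := (zeta g h * zeta (g * h) i * zeta (g * h * i) j)%g.
have EA1 : A = (phi g (o h i j) * o g (h * i) j * o g h i * W)%g.
  rewrite /A oE !autgM -[LHS]gmulA oE (gmulA g) -!gmulA.
  congr (_ * _)%g; rewrite !gmulA -(iotaCo _ _ _ (phi g (zeta h i))).
  rewrite -!gmulA; congr (_ * _)%g; rewrite !gmulA.
  by rewrite oE.
have EA2 : A = (o g h (i * j) * o (g * h) i j * W)%g.
  rewrite /A autgM -(gmulA h) -gmulA oE phi_comp.
  set a := phi (g * h)%g (zeta i j).
  rewrite -(gmulA _ (zeta g h)) gmulA -(iotaCo g h _ (_ * a / _)%g) -!gmulA mulKg.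
  congr (_ * _)%g; rewrite /a oE -(gmulA (o _ _ _)) !gmulA.
  by rewrite -(iotaCo _ _ _ (zeta g h)).
have /mulIg E := etrans (esym EA1) EA2.
have {}E : rho g (z h i j) + z g (h * i)%g j + z g h i =
    z g h (i * j)%g + z (g * h)%g i j.
  by apply: (iota_inj iotaP); rewrite !(iotaD iotaP) actE !zE.
rewrite -(subrr (z g h (i * j)%g + z (g * h)%g i j)) -{1}E opprD addrA.
rewrite [LHS]addrAC [RHS]addrAC; congr (_ + _); rewrite [RHS]addrAC.
by congr (_ + _); rewrite [RHS]addrAC.
Qed.

Let zcochain_cocycle : coboundary rho zcochain = 0.
Proof.
clear zcochain_bounded; clearbody z o.
apply/funext => t; case/tupleP: t => g t; case/tupleP: t => h t.
case/tupleP: t => i t; case/tupleP: t => j t; rewrite (tuple0 t) {t}.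
rewrite /coboundary !big_ord_recl big_ord0 /zcochain !tnth_mktuple.
rewrite !(tnth_nth 1%g) /= /thead !(tnth_nth 1%g) /=.
have e1 : (-1 : int) ^+ 1 = -1 by [].
have e2 : (-1 : int) ^+ 2 = 1 by [].
have e3 : (-1 : int) ^+ 3 = -1 by [].
have e4 : (-1 : int) ^+ 4 = 1 by [].
rewrite -[RHS](z_cocycle g h i j) /bump /= e1 e2 e3 e4.
by rewrite !mulrN1z !mulr1z addr0 !addrA.
Qed.

Lemma obstruction_of_choice : exists c : 3.-tuple G -> Z,
  [/\ bounded_cochain nu c, coboundary rho c = 0 &
      is_obstruction phi zeta (fun g h i => iota (c [tuple g; h; i]))].
Proof.
exists zcochain; split=> // g h i.
by rewrite /zcochain !(tnth_nth 1%g) zE oE.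
Qed.

End Choice.

Lemma obstruction_cocycle_exists :
  exists c : bcocycle rho nu 3, is_obstruction_cocycle c.
Proof.
have [phi [zeta choiceP]] := obstruction_choice_exists.
have [c [cB c0 cE]] := obstruction_of_choice choiceP.
have cP : bcocycle_pred rho nu c by apply/asboolP.
by exists (BCocycle cP), phi, zeta.
Qed.

(* The value does not depend on the choice of phi, zeta and c. *)
Definition omega_b : bcohomology rho nu 3 :=
  bclass (sval (cid obstruction_cocycle_exists)).

End Obstruction.

(* The M-action sigma is only required to restrict to rho along Phi. It need not
   preserve nu outside the image of Phi, and all cochains on M are bounded. *)
Definition finite_pullback_set (R : realType) (G : groupType) (Z : zmodType)
    (rho : gmodule G Z) (nu : znorm R Z) : set (bcohomology rho nu 3) :=
  [set x | exists (M : finGroupType) (sigma : gmodule M Z)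
     (Phi : {multiplicative G -> M})
     (PhiE : forall g z, sigma (Phi g) z = rho g z)
     (alpha : bcohomology sigma nu 3), x = pullback PhiE alpha].
Arguments finite_pullback_set {R G Z} rho nu.

(* Main.v *)
(** A homomorphism psi with finite image factors through the finite group
    M = psi(G), and lifts and factor sets chosen on M pull back to G. As two
    obstruction cocycles of psi differ by the coboundary of a cochain with
    finite image, omega_b(G, N, psi) is the pullback of a class on M.

    Conversely, let c be a 3-cocycle on a finite group M. In the M-module Z^M,
    with action (g a)(k) = a(k g) and with Z embedded by z |-> (k |-> k z), c is
    the coboundary of u(g, h) = c(-, g, h). Hence the action of M on Z^M with
    the factor set u has obstruction c, but the centre of the abelian group Z^M
    is too large. This is repaired by letting Z^M act, with kernel exactly Z, on
    the set X = M x M x Z and replacing Z^M by N = T^X x| Z^M for a nontrivial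
    centreless group T. The permutations (p, k, z) |-> (p, k g, z - c(p, k, g))
    of X extend the automorphisms of Z^M to N, with the same factor set. *)
From HB Require Import structures.
Require Import Defs.
From mathcomp Require Import all_boot all_order all_algebra.
From mathcomp Require Import fingroup perm generic_quotient ring_quotient.
From mathcomp Require Import all_classical reals.

Set Implicit Arguments.
Unset Strict Implicit.
Unset Printing Implicit Defensive.

Import GRing.Theory Num.Theory.

Local Open Scope classical_set_scope.
Local Open Scope ring_scope.

(** * Boundedness and coboundaries in low degree *)

Lemma finite_range_bounded (R : realType) (G : groupType) (Z : zmodType)
    (nu : znorm R Z) n (b : n.-tuple G -> Z) :
  finite_set (range b) -> bounded_cochain nu b.
Proof.
move=> /finite_seqP[s sE]; exists (\sum_(x <- s) nu x) => t.
have bs : b t \in s by have : [set` s] (b t) by rewrite -sE; exists t.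
by rewrite (big_rem _ bs) /= lerDl sumr_ge0 // => x _; exact: znorm_ge0.
Qed.

Section Cochains.
Variables (G : groupType) (Z : zmodType) (rho : gmodule G Z).

Lemma tuple2_eta (t : 2.-tuple G) : t = [tuple nth 1%g t 0; nth 1%g t 1].
Proof. by case: t => [[|x [|y []]] //= tP]; apply/val_inj. Qed.

Lemma tuple3_eta (t : 3.-tuple G) :
  t = [tuple nth 1%g t 0; nth 1%g t 1; nth 1%g t 2].
Proof. by case: t => [[|x [|y [|z []]]] //= tP]; apply/val_inj. Qed.

Lemma coboundary2E (b : 2.-tuple G -> Z) g h i :
  coboundary rho b [tuple g; h; i] =
  rho g (b [tuple h; i]) - b [tuple (g * h)%g; i] + b [tuple g; (h * i)%g]
  - b [tuple g; h].
Proof.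
(* With [b] written as a function of its entries, the faces reduce to entries and tuples with
   different length proofs need not be compared. *)
pose f x y := b [tuple x; y].
have -> : b = fun t => f (tnth t ord0) (tnth t (Ordinal (isT : 1 < 2)%N)).
  by apply/funext => t; rewrite !(tnth_nth 1%g) /f -tuple2_eta.
clearbody f.
rewrite /coboundary !big_ord_recl big_ord0 !tnth_mktuple !(tnth_nth 1%g) /=.
rewrite /thead !(tnth_nth 1%g) /=.
have e1 : (-1 : int) ^+ 1 = -1 by [].
have e2 : (-1 : int) ^+ 2 = 1 by [].
have e3 : (-1 : int) ^+ 3 = -1 by [].
by rewrite /bump /= e1 e2 e3 !mulrN1z !mulr1z addr0 !addrA.
Qed.

Lemma coboundary3E (c : 3.-tuple G -> Z) g h i j :
  coboundary rho c [tuple g; h; i; j] =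
  rho g (c [tuple h; i; j]) - c [tuple (g * h)%g; i; j]
  + c [tuple g; (h * i)%g; j] - c [tuple g; h; (i * j)%g] + c [tuple g; h; i].
Proof.
pose f x y z := c [tuple x; y; z].
have -> : c = fun t => f (tnth t ord0) (tnth t (Ordinal (isT : 1 < 3)%N))
                         (tnth t (Ordinal (isT : 2 < 3)%N)).
  by apply/funext => t; rewrite !(tnth_nth 1%g) /f -tuple3_eta.
clearbody f.
rewrite /coboundary !big_ord_recl big_ord0 !tnth_mktuple !(tnth_nth 1%g) /=.
rewrite /thead !(tnth_nth 1%g) /=.
have e1 : (-1 : int) ^+ 1 = -1 by [].
have e2 : (-1 : int) ^+ 2 = 1 by [].
have e3 : (-1 : int) ^+ 3 = -1 by [].
have e4 : (-1 : int) ^+ 4 = 1 by [].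
by rewrite /bump /= e1 e2 e3 e4 !mulrN1z !mulr1z addr0 !addrA.
Qed.

End Cochains.

(** * Independence of the obstruction class from the factor set *)

(* Unlike obstruction_choice, phi and zeta need not be normalised at 1. *)
Definition factor_set (G N : groupType) (psi : G -> outg N)
    (phi : G -> autg N) (zeta : G -> G -> N) :=
  [/\ forall g, outer (phi g) = psi g, finite_set (range phi),
      finite_set (range (fun p : G * G => zeta p.1 p.2)) &
      forall g h, (phi g * phi h = inner (zeta g h) * phi (g * h))%g].

Lemma obstruction_choice_factor_set (G N : groupType) (psi : G -> outg N)
    phi zeta : obstruction_choice psi phi zeta -> factor_set psi phi zeta.
Proof.
case=> lift fin _ zfin _ _ zE; split=> // g h; apply: autg_eqP => x.
by rewrite autgME -[RHS]/(inner _ (phi (g * h)%g x)) /= zE !autgME autg_invK.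
Qed.

Section Independence.
Variables (R : realType) (G N : groupType) (Z : zmodType).
Variables (rho : gmodule G Z) (nu : znorm R Z).
Variables (iota : Z -> N) (psi : G -> outg N).
Hypothesis iotaP : is_center_embedding iota.
Hypothesis psi_rho : induces_action rho iota psi.

Lemma center_embedding_comm z x : (iota z * x = x * iota z)%g.
Proof.
by have : center_of N (iota z) by rewrite -(iota_range iotaP); exists z.
Qed.

Lemma inner_eq_center (m n : N) :
  inner m = inner n -> exists z, iota z = (m * n^-1)%g.
Proof.
move=> E; have : center_of N (m * n^-1)%g.
  have E1 : inner (m * n^-1)%g = 1%g by rewrite innerM innerV E mulgV.
  move=> x; have := congr1 (fun a : autg N => a x) E1.
  by rewrite autg1E /= => {2}<-; rewrite mulgVK.
by rewrite -(iota_range iotaP) => -[z _ <-]; exists z.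
Qed.

(** A change of lift is absorbed by conjugating the factor set, which keeps the obstruction; a
    central change of the factor set then alters it by a coboundary. *)
Lemma factor_set_obstruction_cohomologous phi zeta phi' zeta'
    (c c' : 3.-tuple G -> Z) :
  factor_set psi phi zeta -> factor_set psi phi' zeta' ->
  is_obstruction phi zeta (fun g h i => iota (c [tuple g; h; i])) ->
  is_obstruction phi' zeta' (fun g h i => iota (c' [tuple g; h; i])) ->
  exists2 b, bounded_cochain nu b & coboundary rho b = c' - c.
Proof.
move=> [lift fin zfin zE] [lift' fin' zfin' zE'] cE cE'.
(* [e] chooses by the pair of automorphisms and not by [g], so [eta] has finite range. The default 1
   never occurs in [eta], as [phi] and [phi'] lift the same [psi]. *)
pose e (a a' : autg N) : N := xget 1%g [set n | a' = (inner n * a)%g].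
pose eta g : N := e (phi g) (phi' g).
have etaE g : phi' g = (inner (eta g) * phi g)%g.
  rewrite /eta /e; case: xgetP => [//|].
  have /outerP[n nE] : outer (phi' g) = outer (phi g) by rewrite lift lift'.
  by move=> /(_ n).
pose zeta'' g h : N := (eta g * phi g (eta h) * zeta g h * (eta (g * h))^-1)%g.
have z''E g h : inner (zeta' g h) = inner (zeta'' g h).
  apply: (mulIg (phi' (g * h)%g)); rewrite -zE' !etaE /zeta'' !innerM innerV.
  by rewrite -inner_conj -!gmulA mulKg -zE (mulKg (phi g)).
have bex g h := inner_eq_center (z''E g h).
(* zeta'' is the factor set of phi', obtained from zeta by conjugation with
   eta; it has the same obstruction as zeta, and zeta' = iota b2 * zeta''. *)
pose bz (n n' : N) : Z := xget 0 [set z | iota z = (n * n'^-1)%g].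
pose b2 g h : Z := bz (zeta' g h) (zeta'' g h).
have b2E g h : zeta' g h = (iota (b2 g h) * zeta'' g h)%g.
  rewrite /b2 /bz; case: xgetP => [z _ ->|]; first by rewrite mulgVK.
  by case: (bex g h) => z E /(_ z).
pose b (t : 2.-tuple G) : Z := b2 (nth 1%g t 0) (nth 1%g t 1).
exists b.
  (* Likewise [bz] depends only on the values of maps with finite range. *)
  apply: finite_range_bounded.
  have efin : finite_set (range eta).
    apply: sub_finite_set (finite_image2 e fin fin') => _ [g _ <-].
    by exists (phi g); [exists g | exists (phi' g) => //; exists g].
  pose ev (a : autg N) (n : N) : N := a n.
  pose m (x y : N) : N := (x * y)%g.
  pose d (x y : N) : N := (x * y^-1)%g.
  have f1 := finite_image2 m efin (finite_image2 ev fin efin).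
  have f2 := finite_image2 bz zfin'
    (finite_image2 d (finite_image2 m f1 zfin) efin).
  apply: sub_finite_set f2 => _ [t _ <-]; rewrite /b.
  move: (nth 1%g t 0) (nth 1%g t 1) => g h.
  exists (zeta' g h); first by exists (g, h).
  exists (zeta'' g h) => //.
  exists (eta g * phi g (eta h) * zeta g h)%g; last first.
    by exists (eta (g * h)%g) => //; exists (g * h)%g.
  exists (eta g * phi g (eta h))%g; last first.
    by exists (zeta g h) => //; exists (g, h).
  exists (eta g); first by exists g.
  exists (phi g (eta h)) => //; exists (phi g); first by exists g.
  by exists (eta h) => //; exists h.
apply/funext => t; rewrite (tuple3_eta t).
move: (nth 1%g t 0) (nth 1%g t 1) (nth 1%g t 2) => g h i {t}.
rewrite coboundary2E /b /= -[RHS]/(c' _ - c _).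
have iC := center_embedding_comm.
have phi_comp k l x :
    (phi k (phi l x) * zeta k l = zeta k l * phi (k * l) x)%g.
  by rewrite -[X in (X * _)%g]autgME zE /= mulgVK.
have E := cE' g h i.
suff : rho g (b2 h i) + b2 g (h * i)%g + c [tuple g; h; i] =
       c' [tuple g; h; i] + b2 g h + b2 (g * h)%g i.
  have subE (x y z u v w : Z) : x + y + u = z + w + v -> x - v + y - w = z - u.
    move=> E3; rewrite [x - v + y]addrAC -[x + y](addrK u) E3.
    by rewrite (addrAC _ v) addrK (addrAC z) addrK.
  exact: subE.
apply: (iota_inj iotaP); rewrite !(Defs.iotaD iotaP).
(* [W] is the product [zeta'' g h * zeta'' (g * h) i]; [z''A] then says that [phi'] and [zeta'']
   have obstruction [c]. *)
pose W := (eta g * phi g (eta h) * zeta g h * phi (g * h)%g (eta i)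
           * zeta (g * h) i * (eta (g * h * i))^-1)%g.
have iM z z' x y : (iota z * x * (iota z' * y) = iota z * iota z' * (x * y))%g.
  by rewrite -!gmulA; congr (_ * _)%g; rewrite !gmulA -(iC z').
apply: (mulIg W).
have z''M : (zeta'' g h * zeta'' (g * h)%g i = W)%g.
  by rewrite /zeta'' /W -!gmulA; do 3!congr (_ * _)%g; rewrite mulKg.
have z''A : (phi' g (zeta'' h i) * zeta'' g (h * i)%g =
             iota (c [tuple g; h; i]) * W)%g.
  rewrite /zeta'' etaE /= !autgM autgV -!gmulA mulKg mulKg.
  rewrite (gmulA (phi g (zeta h i))) cE.
  rewrite !gmulA -(iC _ (_ * _ * phi g _)%g) -!gmulA; do 3!congr (_ * _)%g.
  by rewrite [LHS]gmulA phi_comp -!gmulA.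
have phiz' k z x : phi' k (iota z * x)%g = (iota (rho k z) * phi' k x)%g.
  by rewrite autgM (psi_rho (lift' k)).
(* This product is evaluated twice: by splitting off [b2] and using [c] for [zeta''], then by using
   [c'] for [zeta']. *)
transitivity (phi' g (zeta' h i) * zeta' g (h * i))%g.
  by rewrite !b2E phiz' iM z''A gmulA.
by rewrite E !b2E -gmulA iM z''M !gmulA.
Qed.

End Independence.

(** Lets [omega_b], which rests on a chosen normalised lift, be computed from the unnormalised
    factor sets constructed below. *)
Lemma omega_b_factor_set (R : realType) (G N : groupType) (Z : zmodType)
    (rho : gmodule G Z) (nu : znorm R Z) (iota : Z -> N)
    (psi : {multiplicative G -> outg N})
    (iotaP : is_center_embedding iota) (psi_finite : finite_set (range psi))
    (psi_rho : induces_action rho iota psi) phi zeta (c : bcocycle rho nu 3) :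
  factor_set psi phi zeta ->
  is_obstruction phi zeta (fun g h i => iota (c [tuple g; h; i])) ->
  omega_b nu iotaP psi_finite psi_rho = bclass c.
Proof.
move=> fs cE; rewrite /omega_b; case: cid => c' /= [phi' [zeta' [ch' cE']]].
apply/eqP; rewrite /bclass -Quotient.idealrBE; apply/asboolP.
exact: (factor_set_obstruction_cohomologous nu iotaP psi_rho fs
         (obstruction_choice_factor_set ch') cE cE').
Qed.

(** Factor sets compose with [Phi], and the composite has the pullback of [c] itself as obstruction.
    Both inclusions of the theorem end here. *)
Lemma omega_b_pullback (R : realType) (G M N : groupType) (Z : zmodType)
    (rho : gmodule G Z) (sigma : gmodule M Z) (nu : znorm R Z) (iota : Z -> N)
    (Phi : {multiplicative G -> M})
    (PhiE : forall g z, sigma (Phi g) z = rho g z)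
    (psi : {multiplicative G -> outg N}) (psiM : M -> outg N)
    (iotaP : is_center_embedding iota) (psi_finite : finite_set (range psi))
    (psi_rho : induces_action rho iota psi) phi zeta (c : bcocycle sigma nu 3) :
  (forall g, psiM (Phi g) = psi g) -> factor_set psiM phi zeta ->
  is_obstruction phi zeta (fun g h i => iota (c [tuple g; h; i])) ->
  omega_b nu iotaP psi_finite psi_rho = pullback PhiE (bclass c).
Proof.
move=> psiE [lift fin zfin zE] cE; rewrite pullback_class.
apply: (@omega_b_factor_set _ _ _ _ _ _ _ _ _ _ _ (phi \o Phi)
         (fun g h => zeta (Phi g) (Phi h))).
  split=> [g|||g h] /=; first by rewrite lift.
  - by apply: sub_finite_set fin => _ [g _ <-]; exists (Phi g).
  - by apply: sub_finite_set zfin => _ [[g h] _ <-]; exists (Phi g, Phi h).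
  - by rewrite zE gmulfM.
move=> g h i /=; have := cE (Phi g) (Phi h) (Phi i).
rewrite !gmulfM /pull_cochain => ->; congr (iota (c _) * _ * _)%g.
exact/val_inj.
Qed.

(** * Factoring through a finite group *)

Lemma multiplicative1 (G H : groupType) (f : {multiplicative G -> H}) :
  f 1%g = 1%g.
Proof. by apply: (mulgI (f 1%g)); rewrite -gmulfM !mulg1. Qed.

(** [M] is the image of [psi], carried by an enumeration of its range to obtain a finite type, with
    the product of [H]. *)
Lemma finite_range_factor (G H : groupType) (psi : {multiplicative G -> H}) :
  finite_set (range psi) ->
  exists (M : finGroupType) (Phi : {multiplicative G -> M})
    (j : {multiplicative M -> H}),
    (forall m, exists g, Phi g = m) /\ (forall g, j (Phi g) = psi g).
Proof.
move=> /finite_seqP[s sE].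
have sP x : x \in s <-> exists g, psi g = x.
  have -> : (x \in s) = [set` s] x :> Prop by [].
  by rewrite -sE; split=> [[g _ <-]|[g <-]]; exists g.
have psiV g : psi (g^-1)%g = ((psi g)^-1)%g.
  by apply: (mulgI (psi g)); rewrite -gmulfM !mulgV multiplicative1.
have s1 : 1%g \in s by apply/sP; exists 1%g; rewrite multiplicative1.
have sM (x y : seq_sub s) : (val x * val y)%g \in s.
  have /sP[g gE] := valP x; have /sP[h hE] := valP y.
  by apply/sP; exists (g * h)%g; rewrite gmulfM gE hE.
have sV (x : seq_sub s) : ((val x)^-1)%g \in s.
  by have /sP[g gE] := valP x; apply/sP; exists (g^-1)%g; rewrite psiV gE.
pose one : seq_sub s := SeqSub s1.
pose mul x y : seq_sub s := SeqSub (sM x y).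
pose inv x : seq_sub s := SeqSub (sV x).
have mulA : associative mul by move=> x y z; apply/val_inj; rewrite /= gmulA.
have mul1 : left_id one mul by move=> x; apply/val_inj; rewrite /= mul1g.
have mulr1 : right_id one mul by move=> x; apply/val_inj; rewrite /= mulg1.
have mulV : left_inverse one inv mul.
  by move=> x; apply/val_inj; rewrite /= mulVg.
have mulrV : right_inverse one inv mul.
  by move=> x; apply/val_inj; rewrite /= mulgV.
pose M : finGroupType := HB.pack (seq_sub s)
  (isGroup.Build (seq_sub s) mulA mul1 mulr1 mulV mulrV).
have psis g : psi g \in s by apply/sP; exists g.
pose Phi g : M := SeqSub (psis g).
have PhiM : {morph Phi : x y / (x * y)%g}.
  by move=> x y; apply/val_inj; rewrite /= gmulfM.
pose j (m : M) : H := val (m : seq_sub s).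
have jM : {morph j : x y / (x * y)%g} by [].
pose PhiX : {multiplicative G -> M} :=
  HB.pack Phi (isMultiplicative.Build _ _ Phi PhiM).
pose jX : {multiplicative M -> H} :=
  HB.pack j (isMultiplicative.Build _ _ j jM).
exists M, PhiX, jX; split=> // m.
have /sP[g gE] := valP (m : seq_sub s).
by exists g; apply/val_inj.
Qed.

(** * The group T^X x| Z^M and its centre *)

(* T^X x| Z^M, with X = M * M * Z; sigma enters through the group law only. *)
Record wreath (T M : groupType) (Z : zmodType) (sigma : gmodule M Z) := Wreath {
  wbase : M * M * Z -> T;
  wtop : M -> Z }.
Arguments Wreath {T M Z sigma}.

Section WreathGroup.
Variables (T M : groupType) (Z : zmodType) (sigma : gmodule M Z).

(* a |-> (p, k |-> p a(k) - a(p k)) is additive with kernel Z. *)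
Definition shift (a : M -> Z) (x : M * M * Z) : M * M * Z :=
  (x.1, x.2 + (sigma x.1.1 (a x.1.2) - a (x.1.1 * x.1.2)%g)).

Lemma shift0 : shift 0 = id.
Proof. by apply/funext => -[[p k] z]; rewrite /shift /= gact0 subr0 addr0. Qed.

Lemma shiftD a b x : shift (a + b) x = shift b (shift a x).
Proof.
case: x => [[p k] z]; congr (_, _).
have addE y : (a + b) y = a y + b y by [].
rewrite /= !addE gactD opprD addrACA.
exact: addrA.
Qed.

HB.instance Definition _ := gen_eqMixin (wreath T sigma).
HB.instance Definition _ := gen_choiceMixin (wreath T sigma).

Definition wreath_mul (v w : wreath T sigma) : wreath T sigma :=
  Wreath (fun x => wbase v x * wbase w (shift (wtop v) x))%g (wtop v + wtop w).
Definition wreath_one : wreath T sigma := Wreath (fun=> 1%g) 0.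
Definition wreath_inv (v : wreath T sigma) : wreath T sigma :=
  Wreath (fun x => (wbase v (shift (- wtop v) x))^-1)%g (- wtop v).

Fact wreath_mulA : associative wreath_mul.
Proof.
move=> [t a] [s b] [u d]; congr Wreath; last exact: addrA.
by apply/funext => x; rewrite /= shiftD mulgA.
Qed.

Fact wreath_mul1 : left_id wreath_one wreath_mul.
Proof.
move=> [t a]; congr Wreath; last exact: add0r.
by apply/funext => x; rewrite /= shift0 mul1g.
Qed.

Fact wreath_mulr1 : right_id wreath_one wreath_mul.
Proof.
move=> [t a]; congr Wreath; last exact: addr0.
by apply/funext => x; rewrite /= mulg1.
Qed.

Fact wreath_mulV : left_inverse wreath_one wreath_inv wreath_mul.
Proof.
move=> [t a]; congr Wreath; last exact: addNr.
by apply/funext => x; rewrite /= mulVg.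
Qed.

Fact wreath_mulrV : right_inverse wreath_one wreath_inv wreath_mul.
Proof.
move=> [t a]; congr Wreath; last exact: subrr.
by apply/funext => x; rewrite /= -shiftD subrr shift0 mulgV.
Qed.

HB.instance Definition _ := isGroup.Build (wreath T sigma)
  wreath_mulA wreath_mul1 wreath_mulr1 wreath_mulV wreath_mulrV.

Definition wreath_center (z : Z) : wreath T sigma :=
  Wreath (fun=> 1%g) (fun k => sigma k z).

Lemma shift_invariant (a : M -> Z) x :
  a = sigma^~ (a 1%g) -> shift a x = x.
Proof.
by case: x => [[p k] z] aE; rewrite /shift /= aE /= gactM subrr addr0.
Qed.

Lemma shift_fixed (a : M -> Z) :
  (forall x, shift a x = x) -> a = sigma^~ (a 1%g).
Proof.
move=> fx; apply/funext => p; apply/esym/eqP; rewrite -subr_eq0.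
(* At [(p, 1, 0)] the shift adds p a(1) - a(p), which must vanish. *)
by have := congr1 snd (fx (p, 1%g, 0)); rewrite /= mulg1 add0r => ->.
Qed.

(** Commuting with T^X forces [a] to act trivially on X, so [a] lies in Z, and then each value of
    [t] is central in [T]. Conversely, Z acts trivially on X and Z^M is abelian. *)
Lemma wreath_center_embedding :
  center_of T = [set 1%g] -> (exists s : T, s != 1%g) ->
  is_center_embedding wreath_center.
Proof.
move=> T1 [s s1]; split.
- move=> z w; congr Wreath; first by apply/funext => x; rewrite /= mulg1.
  by apply/funext => k; rewrite gactD.
- by move=> z w /(congr1 (fun v => wtop v 1%g)); rewrite /= !gact1.
- apply/seteqP; split=> [_ [z _ <-] [t a]|[t a] ct].
    congr Wreath; last by rewrite [LHS]addrC.
    apply/funext => x; rewrite /= mul1g mulg1 shift_invariant //.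
    by apply/funext => k; rewrite gact1.
  have comm u x : (t x * u (shift a x) = u x * t x)%g.
    by have := congr1 (fun v => wbase v x) (ct (Wreath u 0)); rewrite /= shift0.
  have aE : a = sigma^~ (a 1%g).
    apply: shift_fixed => x; apply/eqP/negP => /negP ax.
    (* If [a] moved [x], the function equal to [s] at [x] and to 1 elsewhere would give t(x) = s
       t(x). *)
    have := comm (fun y => if y == x then s else 1%g) x.
    rewrite (negPf ax) eqxx mulg1 => /esym/(canRL (mulgK _)).
    by rewrite mulgV => E; rewrite E eqxx in s1.
  exists (a 1%g) => //; congr Wreath; last by rewrite -aE.
  apply/funext => x; have : center_of T (t x).
    by move=> y; have := comm (fun=> y) x.
  by rewrite T1 => ->.
Qed.

(** * The automorphisms attached to a cocycle *)

Section Cocycle.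
Variable c : M -> M -> M -> Z.
Hypothesis cP : forall g h i j, sigma g (c h i j) - c (g * h)%g i j
  + c g (h * i)%g j - c g h (i * j)%g + c g h i = 0.

Definition slide g (x : M * M * Z) : M * M * Z :=
  (x.1.1, x.1.2 * g, x.2 - c x.1.1 x.1.2 g)%g.

Definition slideV g (x : M * M * Z) : M * M * Z :=
  (x.1.1, x.1.2 * g^-1, x.2 + c x.1.1 (x.1.2 * g^-1) g)%g.

Lemma slideK g : cancel (slide g) (slideV g).
Proof. by case=> [[p k] z]; rewrite /slideV /= mulgK subrK. Qed.

Lemma slideVK g : cancel (slideV g) (slide g).
Proof. by case=> [[p k] z]; rewrite /slide /= mulgVK addrK. Qed.

Lemma shift_slide a g x :
  shift a (slide g x) = slide g (shift (fun k => a (k * g)%g) x).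
Proof.
by case: x => [[p k] z]; rewrite /shift /slide /= gmulA addrAC.
Qed.

(** By the cocycle identity at (p, k, g, h), [slide] fails to be an action exactly by the shift of
    c(-, g, h). *)
Lemma slideM g h x :
  slide h (slide g x) = slide (g * h)%g (shift (fun k => c k g h) x).
Proof.
case: x => [[p k] z]; rewrite /slide /= gmulA; congr (_, _).
have /eqP := cP p k g h; rewrite addr_eq0 addrAC => /eqP/(canRL (addrK _)) E.
by rewrite -!addrA; congr (z + _); rewrite addrA E.
Qed.

Definition wreath_slide g (v : wreath T sigma) : wreath T sigma :=
  Wreath (wbase v \o slide g) (fun k => wtop v (k * g)%g).

Fact wreath_slideM g : {morph wreath_slide g : v w / (v * w)%g}.
Proof.
move=> [t a] [s b]; congr Wreath.
by apply/funext => x; rewrite /= shift_slide.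
Qed.

Fact wreath_slide_bij g : bijective (wreath_slide g).
Proof.
exists (fun v => Wreath (wbase v \o slideV g) (fun k => wtop v (k * g^-1)%g)).
- move=> [t a]; congr Wreath; apply/funext => x /=; first by rewrite slideVK.
  by rewrite mulgVK.
- move=> [t a]; congr Wreath; apply/funext => x /=; first by rewrite slideK.
  by rewrite mulgK.
Qed.

Definition wreath_aut g : autg (wreath T sigma) :=
  AutG (wreath_slideM g) (wreath_slide_bij g).

Definition wreath_zeta g h : wreath T sigma :=
  Wreath (fun=> 1%g) (fun k => c k g h).

(** On the base, conjugation by [wreath_zeta g h] is the shift in [slideM]; on the abelian top it is
    trivial. *)
Lemma wreath_autM g h :
  (wreath_aut g * wreath_aut h =
   inner (wreath_zeta g h) * wreath_aut (g * h))%g.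
Proof.
apply: autg_eqP => -[t a]; congr Wreath; apply/funext => x /=.
  by rewrite slideM mul1g invg1 mulg1.
rewrite -[RHS]/(c x g h + a (x * (g * h))%g - c x g h) gmulA.
by rewrite addrAC subrr add0r.
Qed.

(** This is the cocycle identity at (k, g, h, i), read in Z^M; all base components are 1. *)
Lemma wreath_obstruction :
  is_obstruction wreath_aut wreath_zeta (fun g h i => wreath_center (c g h i)).
Proof.
move=> g h i; congr Wreath; apply/funext => k /=; first by rewrite !mulg1.
rewrite -[LHS]/(c (k * g)%g h i + c k g (h * i)%g).
rewrite -[RHS]/(sigma k (c g h i) + c k g h + c k (g * h)%g i).
have /eqP := cP k g h i; rewrite addrAC subr_eq0 [_ - _ + c _ _ _]addrAC.
by rewrite (addrAC _ (- _)) subr_eq [eqbRHS]addrC => /eqP <-; rewrite addrAC.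
Qed.

Lemma outer_wreath_autM :
  {morph (fun g => outer (wreath_aut g)) : g h / (g * h)%g}.
Proof.
move=> g h /=; rewrite -[RHS]outerM; apply/esym/outerP.
by exists (wreath_zeta g h); rewrite wreath_autM.
Qed.

End Cocycle.

End WreathGroup.

Arguments wreath_center {T M Z sigma}.
Arguments wreath_zeta {T M Z sigma}.
Arguments wreath_aut {T M Z sigma}.

(** * Realisation of cocycles and descent of the action *)

Lemma center_S3 : center_of {perm 'I_3} = [set 1%g].
Proof.
apply/seteqP; split=> [t tC|_ ->] /=; last by move=> s; rewrite mulg1 mul1g.
apply/permP => i; rewrite perm1; apply/eqP/negPn/negP => ti.
(* The transposition of [i] and a third point [k] fixes [t i]; commuting with it gives t(i) =
   t(k). *)
have [k] : exists k, k \notin [:: i; t i].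
  apply/existsP; apply: contraTT (isT : 2 < 3)%N.
  rewrite negb_exists => /forallP sub.
  rewrite -leqNgt -[X in (X <= _)%N](card_ord 3).
  apply: leq_trans (card_size [:: i; t i]); apply: subset_leq_card.
  by apply/fintype.subsetP => x _; have := sub x; rewrite negbK.
rewrite !inE negb_or => /andP[ki kti].
have := congr1 (fun s : {perm 'I_3} => s i) (tC (tperm i k)).
rewrite /= !permM tpermL tpermD // 1?eq_sym // => /perm_inj /eqP.
by rewrite eq_sym (negPf ki).
Qed.

(** With T = S_3 the group T^X x| Z^M has obstruction [c] itself, not merely a cohomologous cocycle.
    Finiteness of [M] gives the lift and the factor set finite range. *)
Lemma obstruction_realized (M : finGroupType) (Z : zmodType)
    (sigma : gmodule M Z) (c : 3.-tuple M -> Z) :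
  coboundary sigma c = 0 ->
  exists (N : groupType) (iota : Z -> N) (psi : {multiplicative M -> outg N})
    phi zeta,
    [/\ is_center_embedding iota, induces_action sigma iota psi,
        factor_set psi phi zeta &
        is_obstruction phi zeta (fun g h i => iota (c [tuple g; h; i]))].
Proof.
move=> c0; pose cc g h i := c [tuple g; h; i].
have cP g h i j : sigma g (cc h i j) - cc (g * h)%g i j
  + cc g (h * i)%g j - cc g h (i * j)%g + cc g h i = 0.
  by rewrite -coboundary3E c0.
pose N : groupType := wreath {perm 'I_3} sigma.
pose phi : M -> autg N := wreath_aut cc.
pose psi g : outg N := outer (phi g).
pose psiX : {multiplicative M -> outg N} := HB.pack psi
  (isMultiplicative.Build _ _ psi (@outer_wreath_autM _ _ _ _ _ cP)).
have embP : is_center_embedding (wreath_center : Z -> N).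
  apply: wreath_center_embedding center_S3 _.
  exists (tperm ord0 ord_max); apply/eqP => /permP/(_ ord0).
  by rewrite tpermL perm1.
exists N, wreath_center, psiX, phi, (wreath_zeta cc).
split=> //.
(* A representative of [psi g] is [phi g] up to an inner automorphism, which fixes the centre, and
   [phi g] sends k |-> k z to k |-> k g z. *)
- move=> g a /outerP[n ->] z.
  have -> : (inner n * phi g)%g (wreath_center z) =
            (n * wreath_center (sigma g z) * n^-1)%g.
    rewrite autgME /=; congr (_ * _ * _)%g; congr Wreath.
    by apply/funext => k; rewrite /= gactM.
  by rewrite -(center_embedding_comm embP) mulgK.
- split=> [//|||];
    [exact/finite_image/finite_finset|exact/finite_image/finite_finset|].
  exact: (wreath_autM _ cP).
- exact: (wreath_obstruction _ cP).
Qed.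

(** An element [g] acts on the centre through the outer class [j (Phi g)], so [rho] factors through
    [Phi]. *)
Lemma induces_action_descends (G M N : groupType) (Z : zmodType)
    (rho : gmodule G Z) (iota : Z -> N) (Phi : {multiplicative G -> M})
    (j : M -> outg N) :
  is_center_embedding iota -> (forall m, exists g, Phi g = m) ->
  induces_action rho iota (j \o Phi) ->
  exists2 sigma : gmodule M Z,
    forall g z, sigma (Phi g) z = rho g z & induces_action sigma iota j.
Proof.
move=> iotaP surj act.
have rhoE g h z : Phi g = Phi h -> rho g z = rho h z.
  move=> gh; apply: (iota_inj iotaP).
  rewrite -(act g (repr (j (Phi g)))) ?reprO //.
  by rewrite -(act h (repr (j (Phi g)))) ?reprO //= gh.
(* [r] is only a set-theoretic section; by [sE] the action does not depend on it. *)
pose r m := sval (cid (surj m)).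
have rK m : Phi (r m) = m by exact: (svalP (cid (surj m))).
pose s m z := rho (r m) z.
have sE g z : s (Phi g) z = rho g z by apply: rhoE; rewrite rK.
have s1 z : s 1%g z = z by rewrite -(multiplicative1 Phi) sE gact1.
have sM m n z : s (m * n)%g z = s m (s n z).
  by rewrite -(rK m) -(rK n) -gmulfM !sE gactM.
have sD m z w : s m (z + w) = s m z + s m w by rewrite /s gactD.
exists (GModule s1 sM sD) => [//|m a aE z].
by apply: (act (r m)); rewrite /= rK.
Qed.

Theorem theorem4 (R : realType) (G : groupType) (Z : zmodType)
    (rho : gmodule G Z) (nu : znorm R Z)
    (nu_inv : norm_invariant rho nu) (nu_balls : finite_balls nu)
    (rho_finite : finite_set (range rho)) :
  [set x : bcohomology rho nu 3 |
    exists (N : groupType) (iota : Z -> N)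
      (iotaP : is_center_embedding iota) (psi : {multiplicative G -> outg N})
      (psi_finite : finite_set (range psi))
      (psi_rho : induces_action rho iota psi),
      x = omega_b nu iotaP psi_finite psi_rho]
  = finite_pullback_set rho nu.
Proof.
apply/seteqP; split=> x /=.
- move=> [N [iota [iotaP [psi [psi_fin [psi_rho ->]]]]]].
  have [M [Phi [j [surj jE]]]] := finite_range_factor psi_fin.
  have act : induces_action rho iota (j \o Phi).
    by move=> g a /=; rewrite jE; exact: psi_rho.
  have [sigma PhiE act_j] := induces_action_descends iotaP surj act.
  (* The same [N] thus has an obstruction cocycle over [M] as well. *)
  have j_fin : finite_set (range j) by exact/finite_image/finite_finset.
  have [c [phi [zeta [ch cE]]]] :=
    obstruction_cocycle_exists nu iotaP j_fin act_j.
  exists M, sigma, Phi, PhiE, (bclass c).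
  exact: (omega_b_pullback PhiE iotaP psi_fin psi_rho jE
           (obstruction_choice_factor_set ch) cE).
- move=> [M [sigma [Phi [PhiE [alpha ->]]]]].
  (* A representative is fixed because the construction realises cocycles rather than classes. *)
  have -> : alpha = bclass (repr alpha) by rewrite /bclass reprK.
  set c := repr alpha.
  have /asboolP[_ c0] := bcocycleP c.
  have [N [iota [psiM [phi [zeta [iotaP act fs cE]]]]]] :=
    obstruction_realized c0.
  have psiMor : {morph psiM \o Phi : g h / (g * h)%g}.
    by move=> g h /=; rewrite !gmulfM.
  pose psi : {multiplicative G -> outg N} := HB.pack (psiM \o Phi)
    (isMultiplicative.Build _ _ (psiM \o Phi) psiMor).
  have psi_fin : finite_set (range psi).
    apply: sub_finite_set (finite_image psiM (finite_finset (X := setT))).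
    by move=> _ [g _ <-]; exists (Phi g).
  have psi_rho : induces_action rho iota psi.
    by move=> g a aE z; rewrite (act _ _ aE) PhiE.
  exists N, iota, iotaP, psi, psi_fin, psi_rho.
  by rewrite (omega_b_pullback PhiE iotaP psi_fin psi_rho _ fs cE).
Qed.
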